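(* Let $k$ be a field, let $m\geq 2$ be an integer, let $G$ be a complete $m$-partite graph on the vertex set $V=\{x_1,\ldots,x_n\}$, and let $I(G)\subseteq R=k[x_1,\ldots,x_n]$ be its edge ideal. Then the $s$-th symbolic power $I(G)^{(s)}$ is componentwise linear for every integer $s\geq 1$.
   Context: Let $k$ be a field and $R=k[x_1,\ldots,x_n]$ with the standard grading. Graphs are finite and simple, and vertices of the graph are identified with variables of $R$. Complete $m$-partite graph: a graph $G=(V,E)$ whose vertex set can be partitioned into nonempty sets $V=V_1\cup V_2\cup\cdots\cup V_m$ such that, for distinct vertices $x\in V_i$ and $y\in V_j$, one has $\{x,y\}\in E$ if and only if $i\neq j$. Edge ideal: for a finite simple graph $G=(V,E)$ on $V=\{x_1,\ldots,x_n\}$, $I(G)=\langle x_ix_j \mid \{x_i,x_j\}\in E\rangle\subseteq R$. Symbolic power: for an ideal $I\subseteq R$ and $s\ge 1$, $I^{(s)}=\bigcap_{P\in \mathrm{Ass}(I)}(I^sR_P\cap R)$, where $\mathrm{Ass}(I)$ is the set of associated primes of $I$ (i.e. of $R/I$). If $I$ is a square-free monomial ideal with (irredundant) primary decomposition $I=P_1\cap\cdots\cap P_r$, then $I^{(s)}=P_1^s\cap\cdots\cap P_r^s$. Linear resolution: a homogeneous ideal $I\subseteq R$ generated by homogeneous elements all of the same degree $d$ has a linear resolution if its graded Betti numbers satisfy $\beta_{i,i+j}(I)=0$ for all $i\ge 1$ and all $j\neq d$. The zero ideal is regarded as having a linear resolution. Componentwise linear: for a homogeneous ideal $I$ and integer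 $d\ge 0$, let $\langle I_d\rangle$ be the ideal generated by all homogeneous elements of degree $d$ in $I$. The ideal $I$ is componentwise linear if $\langle I_d\rangle$ has a linear resolution for all $d\ge 0$. *)

(* Defs.v *)
From mathcomp Require Import all_boot all_order all_algebra.
From mathcomp Require Import mpoly.

Set Implicit Arguments.
Unset Strict Implicit.
Unset Printing Implicit Defensive.

Import GRing.Theory.
Local Open Scope ring_scope.

(* Ideals are Prop-valued predicates, compared extensionally.                 *)

Section Ideals.
Variable R : idomainType.
Implicit Types (I P S : R -> Prop).

Definition is_ideal I : Prop :=
  [/\ I 0, (forall f g, I f -> I g -> I (f + g))
    & (forall a f, I f -> I (a * f))].

Definition ideal_gen S (f : R) : Prop :=
  exists (N : nat) (a g : 'I_N -> R),
    (forall i, S (g i)) /\ f = \sum_i a i * g i.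

Definition ideal_pow I (s : nat) : R -> Prop :=
  ideal_gen (fun p => exists g : 'I_s -> R,
    (forall i, I (g i)) /\ p = \prod_i g i).

Definition prime_ideal P : Prop :=
  [/\ is_ideal P, ~ P 1 & forall f g, P (f * g) -> P f \/ P g].

(* P = (I : f) is the annihilator of the class of f in R / I. *)
Definition assoc_prime I P : Prop :=
  prime_ideal P /\ exists f, forall g, P g <-> I (g * f).

(* R_P, as a subring of the field of fractions of the domain R *)
Definition localization P (x : {fraction R}) : Prop :=
  exists a u : R, ~ P u /\ x = tofrac a / tofrac u.

(* I R_P, the ideal of R_P generated by the image of I *)
Definition extension P I (x : {fraction R}) : Prop :=
  exists (N : nat) (r : 'I_N -> {fraction R}) (g : 'I_N -> R),
    [/\ forall i, localization P (r i), forall i, I (g i)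
      & x = \sum_i r i * tofrac (g i)].

Definition symbolic_power I (s : nat) (f : R) : Prop :=
  forall P, assoc_prime I P -> extension P (ideal_pow I s) (tofrac f).

End Ideals.

Section Graded.
Variables (k : fieldType) (n : nat).
Notation R := {mpoly k[n]}.
Implicit Types (I : R -> Prop).

Definition homogeneous_ideal I : Prop :=
  forall f, I f <-> ideal_gen (fun g => I g /\ exists d : nat, g \is d.-homog) f.

Definition generated_in_degree (d : nat) I : Prop :=
  forall f, I f <-> ideal_gen (fun g => I g /\ g \is d.-homog) f.

(* A graded free module (+)_a R(-sF a) is given by the degrees sF of its basis;
   M acts on row vectors, and is a degree 0 map from (+)_a R(-sF a) to
   (+)_b R(-sG b) when its (a, b) entry is homogeneous of degree sF a - sG b
   (hence zero when this difference is negative). *)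
Definition graded_map (p q : nat) (sF : 'I_p -> int) (sG : 'I_q -> int)
    (M : 'M[R]_(p, q)) : Prop :=
  forall a b mon, mon \in msupp (M a b) -> (mdeg mon)%:Z + sG b = sF a.

Definition exact_at (p q r : nat) (M : 'M[R]_(p, q)) (N : 'M[R]_(q, r)) : Prop :=
  forall v : 'rV[R]_q, v *m N = 0 <-> exists w : 'rV[R]_p, v = w *m M.

(* Minimal graded free resolution  ... -> F_1 -> F_0 -> I -> 0, where
   F_i = (+)_(a < res_rank i) R(-res_shift i a). *)
Record min_graded_resolution I := MinGradedResolution {
  res_rank : nat -> nat;
  res_shift : forall i, 'I_(res_rank i) -> int;
  res_aug : 'cV[R]_(res_rank 0);
  res_diff : forall i, 'M[R]_(res_rank i.+1, res_rank i);
  res_aug_graded : graded_map (@res_shift 0%N) (fun=> 0) res_aug;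
  res_diff_graded :
    forall i, graded_map (@res_shift i.+1) (@res_shift i) (res_diff i);
  res_aug_image :
    forall f, I f <-> exists v : 'rV[R]_(res_rank 0), f = (v *m res_aug) 0 0;
  res_exact0 : exact_at (res_diff 0) res_aug;
  res_exactS : forall i, exact_at (res_diff i.+1) (res_diff i);
  (* the image of F_(i+1) lies in (x_1, ..., x_n) F_i *)
  res_minimal : forall i a b, (res_diff i a b)@_(0%MM) = 0
}.

(* beta i j is the multiplicity of R(-j) in F_i; it does not depend on F, as
   minimal graded free resolutions are unique up to isomorphism. *)
Definition graded_betti_numbers I (beta : nat -> int -> nat) : Prop :=
  exists F : min_graded_resolution I,
    forall i j, beta i j = #|[set a | @res_shift _ F i a == j]|.

Definition linear_resolution I : Prop :=
  (forall f, I f <-> f = 0) \/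
  exists d : nat, generated_in_degree d I /\
    exists beta : nat -> int -> nat, graded_betti_numbers I beta /\
      forall (i : nat) (j : int), (1 <= i)%N -> j <> d%:Z ->
        beta i (i%:Z + j) = 0%N.

Definition graded_component_ideal I (d : nat) : R -> Prop :=
  ideal_gen (fun f => I f /\ f \is d.-homog).

Definition componentwise_linear I : Prop :=
  homogeneous_ideal I /\
  forall d : nat, linear_resolution (graded_component_ideal I d).

End Graded.

(* Graphs on {x_1, ..., x_n} are symmetric irreflexive relations on 'I_n. *)

Definition complete_multipartite (n m : nat) (e : rel 'I_n) : Prop :=
  exists V : {set {set 'I_n}},
    [/\ partition V [set: 'I_n], #|V| = m
      & forall A B x y, A \in V -> B \in V -> x \in A -> y \in B -> x != y ->
          e x y = (A != B)].

Definition edge_ideal (k : fieldType) (n : nat) (e : rel 'I_n) :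
    {mpoly k[n]} -> Prop :=
  ideal_gen (fun p => exists i j : 'I_n, e i j /\ p = 'X_i * 'X_j).

Arguments edge_ideal k {n} e _.

(* Main.v *)
Require Import Defs.
From mathcomp Require Import all_boot all_order all_algebra.
From mathcomp Require Import mpoly.

(* Let V_1, ..., V_m be the parts of G. The associated primes of I(G) are the
   ideals P_i generated by the variables outside V_i: P_i = (I(G) : x_a) for any
   a in V_i. Hence x^u lies in I(G)^(s) iff u has degree at least s outside every
   part. In a fixed degree d these monomials satisfy the exchange property of a
   polymatroid: if v < u lexicographically and p is the first index where they
   differ, then v x_p / x_q is again such a monomial for some q with u_q < v_q.
   So, in decreasing lexicographic order, the monomials of degree d have linear
   quotients: each colon ideal (u_1, ..., u_(j-1)) : u_j is generated by
   variables. The syzygies of (u_1, ..., u_j) are an extension of this colon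
   ideal by the syzygies of (u_1, ..., u_(j-1)), and the horseshoe lemma glues
   their linear resolutions; the same argument resolves ideals of variables.
   Resolutions all of whose differentials have linear entries are automatically
   minimal. *)

Set Implicit Arguments.
Unset Strict Implicit.
Unset Printing Implicit Defensive.

Import GRing.Theory Order.TTheory.
Local Open Scope ring_scope.

(** * Linear resolutions of graded submodules *)

Section LinearResolutions.
Variables (k : fieldType) (n : nat).
Notation R := {mpoly k[n]}.

Definition linear_mx p q (D : 'M[R]_(p, q)) : Prop :=
  forall a b, D a b \is 1.-homog.

Definition hpart p (d : nat) (v : 'rV[R]_p) : 'rV[R]_p :=
  map_mx (pihomog mdeg d) v.

Definition submodule p (K : 'rV[R]_p -> Prop) : Prop :=
  [/\ K 0, forall v w, K v -> K w -> K (v + w)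
    & forall a v, K v -> K (a *: v)].

Definition graded_submodule p (K : 'rV[R]_p -> Prop) : Prop :=
  forall d v, K v -> K (hpart d v).

(* K has a linear resolution of length at most t, once its generators are placed
   in degree 1 relative to the ambient free module. *)
Fixpoint linres (t p : nat) (K : 'rV[R]_p -> Prop) : Prop :=
  if t is t'.+1 then
    exists r (D : 'M[R]_(r, p)),
      [/\ linear_mx D, forall v, K v <-> exists w, v = w *m D
        & linres t' (fun w : 'rV_r => w *m D = 0)]
  else forall v, K v <-> v = 0.

Lemma linres_ext t p (K L : 'rV[R]_p -> Prop) :
  (forall v, K v <-> L v) -> linres t K -> linres t L.
Proof.
move=> KL; case: t => [|t] /= => [K0 v|[r [D [lin span lr]]]].
  by rewrite -KL.
by exists r, D; split=> // v; rewrite -KL.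
Qed.

Lemma linresS t p (K : 'rV[R]_p -> Prop) : linres t K -> linres t.+1 K.
Proof.
elim: t p K => [|t IHt] p K.
  move=> K0; exists 0%N, 0; split; first by case.
  - by move=> v; rewrite K0; split=> [->|[w ->]]; [exists 0|]; rewrite mulmx0.
  - by move=> v /=; rewrite [v]thinmx0 mul0mx.
by move=> [r [D [lin span /IHt lr]]]; exists r, D.
Qed.

Lemma linres_leq t u p (K : 'rV[R]_p -> Prop) :
  (t <= u)%N -> linres t K -> linres u K.
Proof. by move/subnK <-; elim: (u - t)%N => //= j IH /IH/linresS. Qed.

Lemma hpart_row_mx p q d (v : 'rV[R]_p) (w : 'rV[R]_q) :
  hpart d (row_mx v w) = row_mx (hpart d v) (hpart d w).
Proof. exact: map_row_mx. Qed.

Lemma hpart_id p d (v : 'rV[R]_p) :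
  (forall i, v 0 i \is d.-homog) -> hpart d v = v.
Proof. by move=> vd; apply/rowP=> i; rewrite mxE pihomog_dE. Qed.

Lemma pihomogM_homog d e (f h : R) : h \is e.-homog ->
  pihomog mdeg (d + e) (f * h) = pihomog mdeg d f * h.
Proof.
move=> he; rewrite [in LHS](mpolyE f) [in RHS](mpolyE f) mulr_suml !raddf_sum /=.
rewrite mulr_suml; apply: eq_bigr => m _.
rewrite -scalerAl !linearZ /= pihomogX -scalerAl; congr (_ *: _).
case: eqP => [md|/eqP md].
  by rewrite pihomog_dE // dhomogM // dhomogX; apply/eqP.
rewrite mul0r; apply: (@pihomog_ne0 _ _ _ (mdeg m + e)%N).
  by rewrite eqn_add2r.
by rewrite dhomogM // dhomogX; apply/eqP.
Qed.

Lemma hpart_mulmx p q d e (v : 'rV[R]_p) (D : 'M[R]_(p, q)) :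
  (forall a b, D a b \is e.-homog) ->
  hpart (d + e) (v *m D) = hpart d v *m D.
Proof.
move=> De; apply/rowP=> j; rewrite !mxE raddf_sum; apply: eq_bigr => i _.
by rewrite !mxE /= pihomogM_homog.
Qed.

Definition rowker p q (D : 'M[R]_(p, q)) (v : 'rV[R]_p) : Prop := v *m D = 0.

Lemma submodule_rowker p q (D : 'M[R]_(p, q)) : submodule (rowker D).
Proof.
rewrite /rowker; split=> [|v w v0 w0|a v v0]; first exact: mul0mx.
  by rewrite mulmxDl v0 w0 addr0.
by rewrite -scalemxAl v0 scaler0.
Qed.

Lemma graded_rowker p q e (D : 'M[R]_(p, q)) :
  (forall a b, D a b \is e.-homog) -> graded_submodule (rowker D).
Proof.
move=> De d v v0; rewrite /rowker -(hpart_mulmx d v De) v0.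
by apply/rowP=> j; rewrite !mxE raddf0.
Qed.

Lemma submodule_mulmx p q (K : 'rV[R]_q -> Prop) (D : 'M[R]_(p, q)) w :
  submodule K -> (forall i, K (row i D)) -> K (w *m D).
Proof.
move=> [K0 KD KZ] Krow; rewrite mulmx_sum_row.
by apply: big_ind => // i _; apply: KZ.
Qed.

(** [K1] is the projection of [K] to the first block and [K2] the kernel of this projection. Lifting
    the generators of [K1] gives a block triangular matrix whose kernel is again such an
    extension. *)
Lemma horseshoe t p1 p2 (K : 'rV[R]_(p1 + p2) -> Prop)
    (K1 : 'rV[R]_p1 -> Prop) (K2 : 'rV[R]_p2 -> Prop) :
    submodule K -> graded_submodule K ->
    (forall v, K1 v <-> exists w, K (row_mx v w)) ->
    (forall w, K2 w <-> K (row_mx 0 w)) ->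
  linres t K1 -> linres t K2 -> linres t K.
Proof.
elim: t p1 p2 K K1 K2 => [|t IHt] p1 p2 K K1 K2 subK grK K1E K2E.
  move=> /= K10 K20 v; split=> [|->]; last by case: subK.
  rewrite -[v]hsubmxK => Kv.
  have l0 : lsubmx v = 0 by apply/K10/K1E; exists (rsubmx v).
  by move: Kv; rewrite l0 -K2E K20 => ->; rewrite row_mx0.
move=> /= [r1 [D1 [lin1 span1 lr1]]] [r2 [D2 [lin2 span2 lr2]]].
have [K0 KD KZ] := subK.
(* The degree 1 part of any lift is again a lift: [K] is graded and the rows of [D1] are already
   linear. *)
have lift i : exists c : 'rV[R]_p2,
    (forall j, c 0 j \is 1.-homog) /\ K (row_mx (row i D1) c).
  have /K1E [c Kc] : K1 (row i D1).
    by apply/span1; exists (delta_mx 0 i); rewrite -rowE.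
  exists (hpart 1 c); split=> [j|]; first by rewrite mxE pihomogP.
  by rewrite -[X in row_mx X](@hpart_id _ 1) -?hpart_row_mx => [|j]; rewrite ?mxE; auto.
have [c cP] := fin_all_exists lift.
pose C := \matrix_i c i; pose D := block_mx D1 C 0 D2.
have linD : linear_mx D.
  move=> a b; rewrite /D /block_mx !mxE.
  case: splitP => i _; rewrite !mxE; case: splitP => j _ //.
  - by rewrite mxE; case: (cP i).
  - by rewrite mxE dhomog0.
have KC w : K (w *m row_mx D1 C).
  apply: submodule_mulmx => // i; rewrite row_row_mx rowK; by case: (cP i).
exists (r1 + r2)%N, D; split=> // [v|].
  split=> [|[w ->]].
    rewrite -[v]hsubmxK => Kv.
    have /span1 [w1 w1E] : K1 (lsubmx v) by apply/K1E; exists (rsubmx v).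
    have /span2 [w2 w2E] : K2 (rsubmx v - w1 *m C).
      apply/K2E; have /(KZ (-1)) := KC w1; move/(KD _ _ Kv).
      by rewrite mul_mx_row scaleN1r opp_row_mx add_row_mx w1E subrr.
    exists (row_mx w1 w2); rewrite mul_row_block mulmx0 addr0 -w1E -w2E.
    by rewrite addrC subrK.
  rewrite -[w]hsubmxK mul_row_block mulmx0 addr0.
  have -> : row_mx (lsubmx w *m D1) (lsubmx w *m C + rsubmx w *m D2) =
      lsubmx w *m row_mx D1 C + row_mx 0 (rsubmx w *m D2).
    by rewrite mul_mx_row add_row_mx addr0.
  by apply: KD => //; apply/K2E/span2; exists (rsubmx w).
(* The kernel of [D] projects onto that of [D1]: if [v *m D1 = 0] then [v *m C] lies in [K2], so
   rows of [D2] can cancel it. *)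
apply: (IHt _ _ _ _ _ (submodule_rowker D) (graded_rowker linD) _ _ lr1 lr2).
  move=> v; split=> [v0|[w]]; last first.
    rewrite /rowker mul_row_block mulmx0 addr0 -row_mx0.
    by case/eq_row_mx.
  have /span2 [w wE] : K2 (v *m C).
    by apply/K2E; rewrite -v0 -mul_mx_row.
  by exists (- w); rewrite /rowker mul_row_block v0 mulmx0 addr0 mulNmx wE subrr row_mx0.
move=> w; rewrite /rowker mul_row_block !mul0mx mulmx0 !add0r -[X in _ <-> _ = X]row_mx0.
by split=> [->//|/eq_row_mx []].
Qed.

(** Unrolls the recursion into a sequence indexed by all of [nat]; beyond the length the modules
    have rank 0. *)
Lemma linres_sequence t p (K : 'rV[R]_p -> Prop) : linres t K ->
  exists (r : nat -> nat) (D0 : 'M[R]_(r 0, p))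
         (D : forall i, 'M[R]_(r i.+1, r i)),
    [/\ linear_mx D0 /\ (forall i, linear_mx (D i)),
        forall v, K v <-> exists w, v = w *m D0,
        exact_at (D 0) D0
      & forall i, exact_at (D i.+1) (D i)].
Proof.
elim: t p K => [|t IHt] p K /=.
  move=> K0; exists (fun=> 0%N), 0, (fun=> 0); split=> //.
  - by split=> [[]|i []].
  - by move=> v; rewrite K0; split=> [->|[w ->]]; [exists 0|]; rewrite mulmx0.
  - by move=> v; split=> _; [exists 0 | ]; rewrite [v]thinmx0 mul0mx.
  - by move=> i v; split=> _; [exists 0 | ]; rewrite [v]thinmx0 mul0mx.
move=> [q [E [linE spanE /IHt [r [D0 [D [[lin0 lin] span ex0 ex]]]]]]].
pose rk i := if i is i'.+1 then r i' else q.
pose D' i : 'M[R]_(rk i.+1, rk i) := if i is i'.+1 then D i' else D0.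
exists rk, E, D'; split=> //.
  by split=> // -[].
by case.
Qed.

Lemma linear_resolution_rowker t p d (g : 'cV[R]_p) (I : R -> Prop) :
    (forall i, g i 0 \is d.-homog) ->
    (forall f, I f <-> exists v : 'rV_p, f = (v *m g) 0 0) ->
    linres t (rowker g) -> linear_resolution I.
Proof.
move=> gd spanI /linres_sequence [r [D0 [D [[lin0 lin] span ex0 ex]]]].
right; exists d; split.
  move=> f; split=> [/spanI [v ->]|[N [a [h [hI ->]]]]].
    exists p, (v 0), (fun i => g i 0); split; last by rewrite mxE.
    move=> i; split=> //; apply/spanI; exists (delta_mx 0 i).
    by rewrite -rowE mxE.
  have [w wE] := fin_all_exists (fun i => (spanI (h i)).1 (hI i).1).
  apply/spanI; exists (\sum_i a i *: w i).
  rewrite mulmx_suml summxE; apply: eq_bigr => i _.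
  by rewrite -scalemxAl mxE -wE.
pose rk i := if i is i'.+1 then r i' else p.
pose Df i : 'M[R]_(rk i.+1, rk i) := if i is i'.+1 then D i' else D0.
have linDf i : linear_mx (Df i) by case: i.
(* Linear differentials raise degrees by one, starting from generators in degree [d], so the whole
   basis of the [i]-th module sits in degree [d + i]. *)
pose sh i (a : 'I_(rk i)) := (d + i)%N%:Z.
have augG : @graded_map k n _ _ (@sh 0%N) (fun=> 0) g.
  move=> a b mon; rewrite ord1 /sh addr0 addn0 => mg.
  by congr Posz; apply: (dhomog_mf (gd a)).
have diffG i : @graded_map k n _ _ (@sh i.+1) (@sh i) (Df i).
  move=> a b mon mD; rewrite (dhomog_mf (linDf i a b) mD) /sh.
  by rewrite -PoszD add1n addnS.
have ex0' : exact_at (Df 0%N) g by move=> v; rewrite -span.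
have exS i : exact_at (Df i.+1) (Df i) by case: i.
have minF i a b : (Df i a b)@_(0%MM) = 0.
  by apply: (dhomog_nemf_coeff (linDf i a b)); rewrite /= mdeg0.
pose F := MinGradedResolution augG diffG spanI ex0' exS minF.
exists (fun i j => #|[set a | @res_shift _ _ _ F i a == j]|); split; first by exists F.
move=> i j _ jd; apply/eqP; rewrite cards_eq0; apply/eqP/setP=> a.
rewrite !inE /= /sh; apply/eqP=> e; apply: jd.
by apply: (addrI i%:Z); rewrite -e addnC PoszD.
Qed.

End LinearResolutions.

(** * Monomial ideals with linear quotients *)

Section Ideals.
Variable A : idomainType.

Lemma ideal_sum (K : A -> Prop) (T : eqType) (r : seq T) (F : T -> A) :
  is_ideal K -> (forall i, i \in r -> K (F i)) -> K (\sum_(i <- r) F i).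
Proof.
by move=> [K0 KD _] KF; rewrite big_seq; apply: big_ind.
Qed.

Lemma ideal_gen_ideal (S : A -> Prop) : is_ideal (ideal_gen S).
Proof.
split.
- by exists 0%N, (fun=> 0), (fun=> 0); rewrite big_ord0; split=> // -[].
- move=> _ _ [N [a [g [gS ->]]]] [M [b [h [hS ->]]]].
  exists (N + M)%N, (fun i => match split i with inl j => a j | inr j => b j end),
    (fun i => match split i with inl j => g j | inr j => h j end); split.
    by move=> i; case: (split i).
  rewrite big_split_ord; congr (_ + _); apply: eq_bigr => i _.
    by case: (splitP (lshift M i)) => [j /= e|j /= e];
      [rewrite (val_inj e) | move: (ltn_ord i); rewrite e ltnNge leq_addr].
  case: (splitP (rshift N i)) => [j /= e|j /= /addnI e].
    by move: (ltn_ord j); rewrite -e ltnNge leq_addr.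
  by rewrite (val_inj e).
- move=> c _ [N [a [g [gS ->]]]]; exists N, (fun i => c * a i), g; split=> //.
  by rewrite mulr_sumr; apply: eq_bigr => i _; rewrite mulrA.
Qed.

Lemma ideal_gen_mem (S : A -> Prop) f : S f -> ideal_gen S f.
Proof.
move=> Sf; exists 1%N, (fun=> 1), (fun=> f); split=> //.
by rewrite big_ord1 mul1r.
Qed.

Lemma ideal_gen_sub (S K : A -> Prop) :
  is_ideal K -> (forall f, S f -> K f) -> forall f, ideal_gen S f -> K f.
Proof.
move=> idK SK _ [N [a [g [gS ->]]]]; apply: ideal_sum => // i _.
by case: idK => _ _; apply; apply: SK.
Qed.

End Ideals.

Section MonomialIdeals.
Variables (k : fieldType) (n : nat).
Notation R := {mpoly k[n]}.
Implicit Types (P : pred 'X_{1..n}) (s : seq 'X_{1..n}) (f : R).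

(** For [P] upclosed this is the monomial ideal whose monomials have their exponents in [P]. *)
Definition supported P f : bool := all P (msupp f).

Definition upclosed P : Prop := forall m m', P m -> P (m + m')%MM.

Lemma supportedX P m : supported P 'X_[m] = P m.
Proof. by rewrite /supported msuppX /= andbT. Qed.

Lemma supported_ideal P : upclosed P -> is_ideal (supported P).
Proof.
move=> upP; split.
- by rewrite /supported (_ : msupp 0 = [::]) //; apply/eqP; rewrite msupp_eq0.
- move=> f g /allP Pf /allP Pg; apply/allP=> m /msuppD_le.
  by rewrite mem_cat => /orP[/Pf|/Pg].
- move=> a f /allP Pf; apply/allP=> m /msuppM_le /allpairsP [[m1 m2] /= [_ m2f ->]].
  by rewrite addmC; apply/upP/Pf.
Qed.

Lemma supported_sub P (K : R -> Prop) :
  is_ideal K -> (forall m, P m -> K 'X_[m]) -> forall f, supported P f -> K f.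
Proof.
move=> idK PK f /allP Pf; rewrite (mpolyE f); apply: ideal_sum => // m mf.
by case: idK => _ _ KM; rewrite -mul_mpolyC; apply/KM/PK/Pf.
Qed.

Lemma supportedMX P f v :
  supported P (f * 'X_[v]) = supported (fun m => P (v + m)%MM) f.
Proof. by rewrite /supported (perm_all _ (msuppMX f v)) all_map. Qed.

Lemma eq_supported P Q f : P =1 Q -> supported P f = supported Q f.
Proof. by move=> PQ; apply: eq_all. Qed.

Definition divisible s : pred 'X_{1..n} := fun m => has (fun u => (u <= m)%MM) s.

Lemma divisible_upclosed s : upclosed (divisible s).
Proof.
move=> m m' /hasP[u us um]; apply/hasP; exists u => //.
exact: lepm_trans um (lem_addr _ _).
Qed.

Definition mcol s : 'cV[R]_(size s) := \col_i 'X_[nth 0%MM s i].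

Lemma mcol_span s f :
  supported (divisible s) f <-> exists w : 'rV_(size s), f = (w *m mcol s) 0 0.
Proof.
split; last first.
  have idK := supported_ideal (@divisible_upclosed s); have [_ _ KM] := idK.
  move=> [w ->]; rewrite mxE; apply: (ideal_sum idK) => i _.
  apply: KM; rewrite mxE supportedX; apply/hasP.
  by exists (nth 0%MM s i); rewrite ?lepm_refl // mem_nth.
pose K g := exists w : 'rV_(size s), g = (w *m mcol s) 0 0.
apply: (@supported_sub _ K).
  split; first by exists 0; rewrite mul0mx mxE.
    by move=> _ _ [v ->] [w ->]; exists (v + w); rewrite mulmxDl [RHS]mxE.
  by move=> a _ [v ->]; exists (a *: v); rewrite -scalemxAl [RHS]mxE.
move=> m /hasP[u /(nthP 0%MM) [i si <-] um].
exists ('X_[m - nth 0%MM s i] *: delta_mx 0 (Ordinal si)).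
by rewrite -scalemxAl -rowE !mxE -mpolyXD submK.
Qed.

Lemma mcol_cons v s :
  mcol (v :: s) = col_mx ('X_[v])%:M (mcol s) :> 'cV_(1 + size s).
Proof.
apply/colP=> i; rewrite !mxE; case: splitP => j e.
  by rewrite mxE [j]ord1 e ord1.
by rewrite mxE e.
Qed.

(** The colon ideal [(s) : x^v], written on rows of length 1 so that [linres] applies. *)
Definition colon s v : 'rV[R]_1 -> Prop :=
  fun w => supported (divisible s) (w 0 0 * 'X_[v]).

(** The first coordinates of the syzygies of [v :: s] form the colon ideal, and the syzygies with
    first coordinate zero are those of [s]. *)
Lemma linres_cons t d v s :
    (forall u, u \in v :: s -> mdeg u = d) ->
  linres t (colon s v) -> linres t (rowker (mcol s)) ->
  linres t (rowker (mcol (v :: s))).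
Proof.
move=> deg; have deg_mcol i : mcol (v :: s) i 0 \is d.-homog.
  by rewrite mxE dhomogX; apply/eqP/deg/mem_nth.
have E (w : 'rV[R]_1) (z : 'rV[R]_(size s)) :
    row_mx w z *m mcol (v :: s) = (w 0 0 * 'X_[v])%:M + z *m mcol s.
  rewrite mcol_cons mul_row_col mul_mx_scalar; congr (_ + _).
  by apply/rowP=> i; rewrite !mxE !ord1 mulrC eqxx.
apply: (@horseshoe _ _ _ 1 (size s)).
- exact: submodule_rowker.
- by apply: (@graded_rowker _ _ _ _ d) => a b; rewrite ord1.
- move=> w; rewrite /colon mcol_span /rowker.
  split=> [[z zE]|[z]].
    exists (- z); rewrite E mulNmx; apply/rowP=> i.
    by rewrite ord1 mxE [X in _ + X]mxE -zE !mxE eqxx subrr.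
  rewrite E => /eqP; rewrite addr_eq0 => /eqP /rowP /(_ 0) zE.
  by exists (- z); rewrite mulNmx -zE mxE eqxx.
- by move=> w; rewrite /rowker E mxE mul0r raddf0 add0r.
Qed.

(* Expresses that the colon ideal (s) : v is generated by variables. *)
Definition lin_colon s (v : 'X_{1..n}) : Prop := forall u, u \in s ->
  exists2 p, (v p < u p)%N & exists2 u', u' \in s & (u' <= v + U_(p))%MM.

Definition mvars (xs : seq 'I_n) : seq 'X_{1..n} := [seq U_(i)%MM | i <- xs].

Lemma divisible_mvars xs m : divisible (mvars xs) m = has (fun i => 0 < m i)%N xs.
Proof. by rewrite /divisible has_map; apply: eq_has => i /=; rewrite lep1mP lt0n. Qed.

(** The variables are the [x_p] with [x_p x^v] in [(s)]. If [x^u] divides [x^m x^v] and [v p < u p],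
    then [x_p] divides [x^m]. *)
Lemma colon_vars s v : lin_colon s v ->
  exists xs, uniq xs /\
    forall f, supported (divisible s) (f * 'X_[v]) = supported (divisible (mvars xs)) f.
Proof.
move=> lin; exists [seq p <- enum 'I_n | divisible s (v + U_(p))%MM].
split=> [|f]; first by rewrite filter_uniq ?enum_uniq.
rewrite supportedMX; apply: eq_supported => m; apply/idP/hasP.
  move=> /hasP[u us uvm]; have [p vup [u' u's u'v]] := lin u us.
  exists U_(p)%MM.
    apply: map_f; rewrite mem_filter mem_enum andbT.
    by apply/hasP; exists u'.
  apply/mnm_lepP=> j; rewrite mnm1E; case: eqP => [<-|//].
  move/mnm_lepP/(_ p): uvm; rewrite mnmDE => /(leq_trans vup).
  by rewrite -[X in (X < _)%N]addn0 ltn_add2l.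
move=> [_ /mapP [p + ->]]; rewrite mem_filter => /andP[div _] pm.
by rewrite -(submK pm) [(_ + U_(p))%MM]addmC addmA; apply: divisible_upclosed.
Qed.

(** The two claims feed each other: an ideal of variables is resolved by its generators followed by
    their syzygies, and the syzygies of [i :: xs] involve the colon ideal [(xs) : x_i]. *)
Lemma linres_vars xs : uniq xs ->
  linres (size xs) (rowker (mcol (mvars xs))) /\
  linres (size xs).+1 (fun w : 'rV[R]_1 => supported (divisible (mvars xs)) (w 0 0)).
Proof.
elim: xs => [_|i xs IHxs] /=.
  have lr0 : linres 0 (rowker (mcol (mvars [::]))).
    by move=> v; split=> [_|->]; [apply/rowP; case | rewrite /rowker mul0mx].
  split=> //; exists 0%N, (mcol [::]); split=> [[]//|v|//].
  by rewrite mcol_span; split=> -[w wE]; exists w;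
    [rewrite [LHS]mx11_scalar wE -mx11_scalar | rewrite wE].
move=> /andP[ixs uxs]; have [lk lid] := IHxs uxs.
have lk' : linres (size xs).+1 (rowker (mcol (mvars (i :: xs)))).
  apply: (@linres_cons _ 1).
  - by move=> u /(mapP (s := i :: xs)) [j _ ->]; rewrite mdeg1.
  (* As [i] is not in [xs], multiplying by [x_i] does not affect divisibility by the variables of
     [xs], so the colon ideal is [(xs)] itself. *)
  - apply: linres_ext lid => w.
    rewrite /colon supportedMX.
    have -> : supported (fun m => divisible (mvars xs) (U_(i) + m)%MM) (w 0 0) =
        supported (divisible (mvars xs)) (w 0 0); last by [].
    apply: eq_supported => m; rewrite !divisible_mvars; apply: eq_in_has => j jxs.
    by rewrite mnmDE mnm1E; case: eqP ixs => // ->; rewrite jxs.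
  - exact: linresS.
split=> //; exists (size (mvars (i :: xs))), (mcol (mvars (i :: xs))).
split=> // [a b|v].
  rewrite mxE dhomogX; apply/eqP.
  have /mapP [j _ ->] : nth 0%MM (mvars (i :: xs)) a \in mvars (i :: xs).
    exact: mem_nth.
  exact: mdeg1.
by rewrite (mcol_span (mvars (i :: xs))); split=> -[w wE]; exists w;
    [rewrite [LHS]mx11_scalar wE -mx11_scalar | rewrite wE].
Qed.

Fixpoint linear_quotients s : Prop :=
  if s is v :: s' then lin_colon s' v /\ linear_quotients s' else True.

Lemma linear_quotients_linres d s :
  (forall u, u \in s -> mdeg u = d) -> linear_quotients s ->
  linres n.+1 (rowker (mcol s)).
Proof.
elim: s => [_ _|v s IHs deg [lin lq]].
  apply: (@linres_leq _ _ 0) => // v.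
  by split=> [_|->]; [apply/rowP; case | rewrite /rowker mul0mx].
apply: (linres_cons deg); last first.
  by apply: IHs => // u us; apply: deg; rewrite inE us orbT.
have [xs [uxs xsE]] := colon_vars lin.
have [_ lid] := linres_vars uxs.
(* At most [n] distinct variables occur, so [n.+1] bounds all the lengths at once. *)
apply: (@linres_leq _ _ (size xs).+1); first 
  rewrite ltnS -[X in (_ <= X)%N]size_enum_ord uniq_leq_size // => i.
  by rewrite mem_enum.
by apply: linres_ext lid => w; rewrite /colon xsE.
Qed.

End MonomialIdeals.

(** * Degree components of monomial ideals *)

Section ComponentwiseLinear.
Variables (k : fieldType) (n : nat).
Notation R := {mpoly k[n]}.
Implicit Types (P : pred 'X_{1..n}) (s : seq 'X_{1..n}) (f : R).

(** Sorted increasingly because [linear_quotients] takes the colon ideal of the tail by the head, so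
    generators are added from the largest down. In a fixed degree the order is lexicographic. *)
Definition degree_part P (d : nat) : seq 'X_{1..n} :=
  sort <=%O [seq m <- map val (enum {: 'X_{1..n < d.+1}}) | P m && (mdeg m == d)].

Lemma mem_degree_part P d m : (m \in degree_part P d) = P m && (mdeg m == d).
Proof.
rewrite mem_sort mem_filter; apply: andb_idr => /andP[_ /eqP md].
have md' : (mdeg m < d.+1)%N by rewrite md.
by apply/mapP; exists (BMultinom md'); rewrite ?mem_enum.
Qed.

Lemma degree_part_sorted P d : sorted <%O (degree_part P d).
Proof.
rewrite sort_lt_sorted filter_uniq // map_inj_uniq ?enum_uniq //.
exact: val_inj.
Qed.

(** In a sorted list [v < u'] forces [u'] into the tail after [v], where [lin_colon] looks for
    it. *)
Lemma linear_quotients_exchange s :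
    sorted <%O s ->
    (forall u v, u \in s -> v \in s -> (v < u)%O ->
      exists2 p, (v p < u p)%N &
        exists u', [/\ u' \in s, (v < u')%O & (u' <= v + U_(p))%MM]) ->
  linear_quotients s.
Proof.
elim: s => //= v s IHs vs exch.
have /allP v_lt := order_path_min lt_trans vs.
split=> [u us|].
  have [||p vup [u' [u's vu' u'v]]] := exch u v _ _ (v_lt u us).
  - by rewrite inE us orbT.
  - by rewrite inE eqxx.
  exists p => //; exists u' => //.
  by move: u's vu'; rewrite inE => /orP[/eqP->|//]; rewrite ltxx.
apply: IHs => [|u w us ws wu]; first exact: path_sorted vs.
have [||p wup [u' [u's wu' u'w]]] := exch u w _ _ wu; rewrite ?inE ?us ?ws ?orbT //.
exists p => //; exists u'; split=> //.
move: u's; rewrite inE => /orP[/eqP u'v|//].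
by have := lt_trans (v_lt w ws) wu'; rewrite u'v ltxx.
Qed.

(** Every monomial of a form of degree [d] in [I] is in [degree_part P d], so these monomials
    generate the ideal of the degree [d] component. *)
Lemma componentwise_linear_supported P (I : R -> Prop) :
    upclosed P -> (forall f, I f <-> supported P f) ->
    (forall d, linear_quotients (degree_part P d)) ->
  componentwise_linear I.
Proof.
move=> upP IE lq; have idP := supported_ideal k upP.
split=> [f|d].
  split=> [/IE Pf|].
    refine (supported_sub (ideal_gen_ideal _) _ Pf) => m Pm.
    apply: ideal_gen_mem; split; first by apply/IE; rewrite supportedX.
    by exists (mdeg m); rewrite dhomogX.
  by move=> If; apply/IE; move: f If; apply: (ideal_gen_sub idP) => f [/IE].
have deg u : u \in degree_part P d -> mdeg u = d.
  by rewrite mem_degree_part => /andP[_ /eqP].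
apply: (@linear_resolution_rowker k n n.+1 _ d (mcol k (degree_part P d))).
- by move=> i; rewrite mxE dhomogX; apply/eqP/deg/mem_nth.
- move=> f; rewrite -mcol_span; split=> [|Pf].
    move: f; apply: (ideal_gen_sub (supported_ideal k (@divisible_upclosed n _))).
    move=> f [/IE /allP Pf fd]; apply/allP=> m mf; apply/hasP.
    exists m; last exact: lepm_refl.
    by rewrite mem_degree_part Pf //= (dhomog_mf fd).
  refine (supported_sub (ideal_gen_ideal _) _ Pf) => m /hasP [u].
  rewrite mem_degree_part => /andP[Pu du] um.
  rewrite -(submK um) mpolyXD.
  have [_ _ gM] := ideal_gen_ideal (fun f => I f /\ f \is d.-homog).
  apply/gM/ideal_gen_mem; split; first by apply/IE; rewrite supportedX.
  by rewrite dhomogX.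
- exact: linear_quotients_linres deg (lq d).
Qed.

End ComponentwiseLinear.

(** * Weights and powers of ideals generated by variables *)

Lemma coef_mul_eq0 (A : idomainType) (p q : {poly A}) t : p`_0 != 0 ->
  (forall i, (i < t)%N -> (p * q)`_i = 0) ->
  forall i, (i < t)%N -> q`_i = 0.
Proof.
move=> p0 pq0; elim/ltn_ind=> i IHi it; apply/eqP.
(* Only the constant coefficient of [p] times the [i]-th coefficient of [q] survives: all other
   terms contain a coefficient of [q] of smaller index. *)
have /eqP := pq0 i it; rewrite coefM big_ord_recl subn0 big1 ?addr0.
  by rewrite mulf_eq0 (negPf p0).
move=> j _; rewrite IHi ?mulr0 // lift0.
  by rewrite ltn_subrL /=; apply: leq_ltn_trans (ltn_ord j).
exact: leq_ltn_trans (leq_subr _ _) it.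
Qed.

Section Weights.
Variables (k : fieldType) (n : nat).
Notation R := {mpoly k[n]}.
Implicit Types (B : {set 'I_n}) (m : 'X_{1..n}) (f g : R).

Definition wt B m : nat := (\sum_(i in B) m i)%N.

Lemma wtD B m1 m2 : wt B (m1 + m2)%MM = (wt B m1 + wt B m2)%N.
Proof. by rewrite /wt -big_split; apply: eq_bigr => i _; rewrite mnmDE. Qed.

Lemma wt1 B i : wt B U_(i)%MM = (i \in B).
Proof.
rewrite /wt; case: (boolP (i \in B)) => iB.
  rewrite (bigD1 i) //= mnm1E eqxx big1 // => j /andP[_ ji].
  by rewrite mnm1E eq_sym (negPf ji).
by rewrite big1 // => j jB; rewrite mnm1E; case: eqP iB => // ->; rewrite jB.
Qed.

Lemma wtMn B i t : wt B (U_(i) *+ t)%MM = ((i \in B) * t)%N.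
Proof.
rewrite -wt1 /wt big_distrl; apply: eq_bigr => j _; exact: mulmnE.
Qed.

Lemma wt_gt0 B m : (0 < wt B m)%N -> exists2 i, i \in B & (0 < m i)%N.
Proof.
rewrite lt0n sum_nat_eq0 negb_forall => /existsP [i].
by rewrite negb_imply -lt0n => /andP[]; exists i.
Qed.

Lemma mdeg_wt B m : mdeg m = (wt B m + wt (~: B) m)%N.
Proof.
rewrite mdegE (bigID (mem B)) /=; congr addn.
by apply: eq_bigl => i; rewrite inE.
Qed.

Lemma wt_setT m : wt [set: 'I_n] m = mdeg m.
Proof. by rewrite mdegE; apply: eq_bigl => i; rewrite inE. Qed.

Lemma wt_exchange B (u v : 'X_{1..n}) p : p \in B -> (v p < u p)%N ->
  (wt B u <= wt B v)%N -> exists2 q, q \in B & (u q < v q)%N.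
Proof.
move=> pB vup uv; case: (boolP [exists q in B, u q < v q]%N) => [/exists_inP [q]|].
  by exists q.
rewrite negb_exists_in => /forall_inP le.
suff : (wt B v < wt B u)%N by rewrite ltnNge uv.
rewrite /wt (bigD1 p) //= [X in (_ < X)%N](bigD1 p) //= -addSn leq_add //.
by apply: leq_sum => i /andP[iB _]; rewrite leqNgt le.
Qed.

(** The exponents of the monomials in the [t]-th power of the ideal generated by the variables in
    [B]. *)
Definition wt_ge B (t : nat) : pred 'X_{1..n} := fun m => (t <= wt B m)%N.

Lemma wt_ge_upclosed B t : upclosed (wt_ge B t).
Proof. by move=> m m' /leq_trans; apply; rewrite wtD leq_addr. Qed.

Lemma supported_wtM B t1 t2 f g : supported (wt_ge B t1) f ->
  supported (wt_ge B t2) g -> supported (wt_ge B (t1 + t2)) (f * g).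
Proof.
move=> /allP f1 /allP g2; apply/allP=> m /msuppM_le /allpairsP [[m1 m2] /= [mf mg ->]].
by rewrite /wt_ge wtD; apply: leq_add (f1 _ mf) (g2 _ mg).
Qed.

(** The substitution [x_i -> x_i T] for [i] in [B], fixing the other variables. The coefficient at
    [T^t] is the part of weight [t], so lower bounds on weights become bounds on the order in
    [T]. *)
Definition wt_poly B : R -> {poly R} :=
  mmap (polyC \o @mpolyC n k) (fun i => ('X_i)%:P * 'X^(i \in B)).

Lemma wt_polyM B : {morph wt_poly B : f g / f * g}.
Proof. exact: rmorphM. Qed.

Lemma wt_polyE B f :
  wt_poly B f = \sum_(m <- msupp f) (f@_m *: 'X_[m])%:P * 'X^(wt B m).
Proof.
apply: eq_bigr => m _; rewrite /= /mmap1.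
under eq_bigr => i _ do rewrite exprMn -exprM -rmorphXn.
rewrite big_split /= -rmorph_prod -mpolyXE_id mulrA -rmorphM mul_mpolyC.
congr (_ * _); rewrite /wt.
rewrite -(big_morph _ (exprD 'X) (expr0 'X)) [in RHS]big_mkcond /=.
by congr ('X ^+ _); apply: eq_bigr => i _; case: (i \in B); rewrite ?mul1n ?mul0n.
Qed.

Lemma coef_wt_poly B f t m :
  ((wt_poly B f)`_t)@_m = if wt B m == t then f@_m else 0.
Proof.
rewrite wt_polyE coef_sum raddf_sum /=.
under eq_bigr => m' _ do rewrite coefCM coefXn mulr_natr mcoeffMn mcoeffZ mcoeffX.
case: (boolP (m \in msupp f)) => mf; last first.
  rewrite big_seq big1 => [|m' m'f].
    by rewrite (memN_msupp_eq0 mf) if_same.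
  by case: eqP mf m'f => [->|_ _ _]; [move/negP | rewrite mulr0 mul0rn].
rewrite (bigD1_seq m) //= eqxx mulr1 big1 ?addr0 => [|m' /negPf ->].
  by rewrite eq_sym; case: eqP.
by rewrite mulr0 mul0rn.
Qed.

Lemma supported_wt B t f :
  reflect (forall i, (i < t)%N -> (wt_poly B f)`_i = 0) (supported (wt_ge B t) f).
Proof.
apply: (iffP allP) => [ft i it|ft m].
  apply/mpolyP=> m; rewrite coef_wt_poly mcoeff0; case: eqP => // mi.
  by apply: memN_msupp_eq0; apply/negP=> /ft; rewrite /wt_ge mi leqNgt it.
rewrite mcoeff_msupp /wt_ge leqNgt; apply: contra => mt.
by have := coef_wt_poly B f (wt B m) m; rewrite ft // mcoeff0 eqxx => <-.
Qed.

(* The ideal generated by the variables in B is prime, and its powers are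
   primary. *)
Lemma supported_wt_primary B t u f : ~~ supported (wt_ge B 1) u ->
  supported (wt_ge B t) (u * f) -> supported (wt_ge B t) f.
Proof.
move=> uB /supported_wt ufB; apply/supported_wt.
(* [u] lies outside the prime, so its coefficient at [T^0] is nonzero and multiplying by [u] keeps
   the order in [T]. *)
apply: (@coef_mul_eq0 _ (wt_poly B u)).
  by apply: contra uB => /eqP u0; apply/supported_wt=> -[].
by move=> i it; rewrite -wt_polyM ufB.
Qed.

Lemma supported_wt_prime B : prime_ideal (supported (wt_ge B 1) : R -> Prop).
Proof.
split; first exact/supported_ideal/wt_ge_upclosed.
  by rewrite -mpolyX0 supportedX /wt_ge /wt big1 // => i _; rewrite mnm0E.
move=> f g fg; case: (boolP (supported (wt_ge B 1) f)) => [|nf]; first by left.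
by right; apply: supported_wt_primary nf fg.
Qed.

End Weights.

(** * Symbolic powers of the edge ideal *)

Section IdealPowers.
Variable A : idomainType.
Implicit Types (I P K : A -> Prop).

Lemma ideal_pow0 I f : ideal_pow I 0 f.
Proof.
have [_ _ gM] := ideal_gen_ideal (fun p => exists g : 'I_0 -> A,
  (forall i, I (g i)) /\ p = \prod_i g i).
rewrite -[f]mulr1; apply/gM/ideal_gen_mem; exists (fun=> 0).
by split=> [[]//|]; rewrite big_ord0.
Qed.

Lemma ideal_powS I s f g : I f -> ideal_pow I s g -> ideal_pow I s.+1 (f * g).
Proof.
move=> If [N [a [h [hI ->]]]]; exists N, a, (fun i => f * h i).
split=> [i|]; last by rewrite mulr_sumr; apply: eq_bigr => i _; rewrite mulrCA.
have [g' [g'I ->]] := hI i.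
exists (fun j => if unlift ord0 j is Some j' then g' j' else f); split=> [j|].
  by case: (unlift ord0 j).
rewrite big_ord_recl unlift_none; congr (_ * _).
by apply: eq_bigr => j _; rewrite liftK.
Qed.

(** The product of the denominators is a common denominator, and it stays outside [P] because [P] is
    prime. *)
Lemma extension_denominator P K x : prime_ideal P -> is_ideal K ->
  extension P K x -> exists u a, [/\ ~ P u, K a & x * tofrac u = tofrac a].
Proof.
move=> [[P0 _ _] P1 Pprime] [K0 KD KM] [N [r [g [rP gK ->]]]].
apply: (big_ind (fun x => exists u a, [/\ ~ P u, K a & x * tofrac u = tofrac a])).
- by exists 1, 0; rewrite mul0r tofrac0.
- move=> y z [u [a [uP aK yu]]] [v [b [vP bK zv]]].
  exists (u * v), (a * v + b * u); split.
  - by move=> uvP; case: (Pprime _ _ uvP).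
  - by apply: KD; rewrite mulrC; apply: KM.
  - rewrite tofracD !tofracM -yu -zv mulrDl mulrA.
    by rewrite [z * _]mulrCA [_ u * (z * _)]mulrC.
- move=> i _; have [b [v [vP ->]]] := rP i.
  have v0 : tofrac v != 0 by rewrite tofrac_eq0; apply/eqP=> v0; rewrite v0 in vP.
  exists v, (b * g i); split; [by [] | exact: KM |].
  by rewrite tofracM mulrAC divfK.
Qed.

End IdealPowers.

Section CompleteMultipartite.
Variables (k : fieldType) (n : nat) (e : rel 'I_n) (V : {set {set 'I_n}}).
Notation R := {mpoly k[n]}.
Hypothesis partV : partition V [set: 'I_n].
Hypothesis eV : forall A B x y, A \in V -> B \in V -> x \in A -> y \in B ->
  x != y -> e x y = (A != B).
Hypothesis e_irr : irreflexive e.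

Let trivV : trivIset V. Proof. by case/and3P: partV. Qed.

Let pblockV i : pblock V i \in V.
Proof. by rewrite pblock_mem // (cover_partition partV). Qed.

Let mem_pblockV i : i \in pblock V i.
Proof. by rewrite mem_pblock (cover_partition partV). Qed.

Let pblockE B i : B \in V -> i \in B -> pblock V i = B.
Proof. exact: def_pblock. Qed.

(* The exponents m of the monomials in all P_B ^ s, where the minimal prime P_B
   is generated by the variables outside the part B. *)
Definition min_primes_pow (s : nat) : pred 'X_{1..n} :=
  fun m => [forall B in V, wt_ge (~: B) s m].

Lemma min_primes_powP s m :
  reflect (forall B, B \in V -> s <= wt (~: B) m)%N (min_primes_pow s m).
Proof. exact: forall_inP. Qed.

Lemma min_primes_pow_upclosed s : upclosed (min_primes_pow s).
Proof.
by move=> m m' /forall_inP Pm; apply/forall_inP=> B /Pm; apply: wt_ge_upclosed.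
Qed.

Lemma supported_min_primes_pow s (f : R) :
  supported (min_primes_pow s) f <->
  forall B, B \in V -> supported (wt_ge (~: B) s) f.
Proof.
split=> [/allP Pf B BV|Pf]; apply/allP=> m mf.
  by have /forall_inP := Pf m mf; apply.
by apply/forall_inP=> B BV; apply: (allP (Pf B BV)).
Qed.

Lemma edge_notin B i j : B \in V -> e i j -> (i \notin B) || (j \notin B).
Proof.
move=> BV eij; rewrite -negb_and; apply/negP=> /andP[iB jB].
have ij : i != j by apply: contraTneq eij => ->; rewrite e_irr.
by rewrite (eV BV BV iB jB ij) eqxx in eij.
Qed.

Lemma edge_pblock i j : i \notin pblock V j -> e j i.
Proof.
move=> ij; rewrite (eV (pblockV j) (pblockV i)) //.
  by apply: contraNneq ij => ->.
by apply: contraNneq ij => ->.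
Qed.

Hypothesis V_neq0 : V != set0.

(** A monomial with positive weight outside every part involves some [x_i], and also some [x_j]
    outside the part of [i]; these two form an edge. *)
Lemma edge_idealE (f : R) :
  edge_ideal k e f <-> supported (min_primes_pow 1) f.
Proof.
split.
  move: f; apply: (ideal_gen_sub (supported_ideal k (@min_primes_pow_upclosed 1))).
  move=> _ [i [j [eij ->]]]; rewrite -mpolyXD supportedX.
  apply/min_primes_powP=> B BV; rewrite wtD !wt1 !inE.
  by case/orP: (edge_notin BV eij) => ->; rewrite ?addn1.
move=> If; refine (supported_sub (ideal_gen_ideal _) _ If) => m /min_primes_powP mV.
have /set0Pn [B BV] := V_neq0.
have [i _ mi] := wt_gt0 (mV B BV).
have [j] := wt_gt0 (mV _ (pblockV i)); rewrite inE => ji mj.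
have ij : i != j by apply: contraNneq ji => <-.
have ijm : (U_(i) + U_(j) <= m)%MM.
  apply/mnm_lepP=> h; rewrite mnmDE !mnm1E.
  case: eqP => [<-|_]; last by case: eqP => [<-|].
  by rewrite [j == i]eq_sym (negPf ij).
rewrite -(submK ijm) 2!mpolyXD.
have [_ _ gM] := ideal_gen_ideal (fun p : R => exists i j, e i j /\ p = 'X_i * 'X_j).
by apply/gM/ideal_gen_mem; exists i, j; split=> //; apply: edge_pblock.
Qed.

Lemma assoc_prime_part B : B \in V ->
  assoc_prime (edge_ideal k e) (supported (wt_ge (~: B) 1) : R -> Prop).
Proof.
move=> BV; split; first exact: supported_wt_prime.
have /set0Pn [a aB] : B != set0.
  by apply: contraTneq BV => ->; case/and3P: partV.
exists 'X_a => g; rewrite edge_idealE supportedMX.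
(* Multiplication by [x_a] already gives weight 1 outside every part other than [B], so only the
   condition at [B] remains. *)
have -> : supported (fun m => min_primes_pow 1 (U_(a) + m)%MM) g =
    supported (wt_ge (~: B) 1) g; last by [].
apply: eq_supported => m; apply/min_primes_powP/idP=> [/(_ B BV)|mB C CV].
  by rewrite wtD wt1 inE aB.
rewrite wtD wt1 inE; case: (boolP (a \in C)) => //= aC.
by rewrite -(pblockE CV aC) (pblockE BV aB).
Qed.

Lemma edge_pow_supported s B (f : R) : B \in V ->
  ideal_pow (edge_ideal k e) s f -> supported (wt_ge (~: B) s) f.
Proof.
move=> BV; have idB := supported_ideal k (@wt_ge_upclosed n (~: B) s).
move: f; apply: (ideal_gen_sub idB).
move=> _ [g [gI ->]]; elim: s {idB} g gI => [|s IHs] g gI.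
  by apply/allP.
rewrite big_ord_recl; apply: (@supported_wtM _ _ _ 1 s); last exact: IHs.
by have /edge_idealE/supported_min_primes_pow := gI ord0; apply.
Qed.

(** Each of [s] factors of [x^m] outside the part of [a] pairs with one copy of [x_a] to form an
    edge. *)
Lemma edge_pow_mulX s a m : (s <= wt (~: pblock V a) m)%N ->
  ideal_pow (edge_ideal k e) s ('X_a ^+ s * 'X_[m] : R).
Proof.
elim: s m => [|s IHs] m sm; first exact: ideal_pow0.
have [i] := wt_gt0 (leq_ltn_trans (leq0n s) sm); rewrite inE => ia mi.
have im : (U_(i) <= m)%MM by rewrite lep1mP -lt0n.
rewrite -(submK im) addmC mpolyXD exprS mulrACA.
apply: ideal_powS.
  by apply: ideal_gen_mem; exists a, i; split=> //; apply: edge_pblock.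
apply: IHs; move: sm; rewrite -{1}(submK im) wtD wt1 inE ia.
by rewrite addn1.
Qed.

Lemma symbolic_powerE s (f : R) :
  symbolic_power (edge_ideal k e) s f <-> supported (min_primes_pow s) f.
Proof.
split=> [If|].
  apply/supported_min_primes_pow=> B BV.
  have := If _ (assoc_prime_part BV).
  case/(extension_denominator (supported_wt_prime k (~: B)) (ideal_gen_ideal _)).
  (* Here [u f] lies in [I(G)^s], hence in the [s]-th power of the prime of [B]; this power is
     primary and [u] is outside the prime. *)
  move=> u [a [/negP uB aI]] /eqP; rewrite -tofracM tofrac_eq => /eqP fu.
  by apply: (supported_wt_primary uB); rewrite mulrC fu; apply: edge_pow_supported.
move=> /supported_min_primes_pow fV P [[idP P1 Pprime] [g Pg]].
(* With [P = (I(G) : g)] and [1] not in [P], [g] is not in [I(G)], so it misses the prime of some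
   part [B]. *)
have [B BV gB] : exists2 B, B \in V & ~~ supported (wt_ge (~: B) 1) g.
  apply/exists_inP; apply: contra_notT P1; rewrite negb_exists_in => /forall_inP gV.
  apply/Pg; rewrite mul1r; apply/edge_idealE/supported_min_primes_pow=> B BV.
  by have := gV B BV; rewrite negbK.
have /set0Pn [a aB] : B != set0.
  by apply: contraTneq BV => ->; case/and3P: partV.
(* Otherwise [x_a^s g] would lie in the prime of [B], which contains neither [g] nor a power of
   [x_a]. *)
have aP : ~ P ('X_a ^+ s).
  move=> /Pg /edge_idealE /supported_min_primes_pow /(_ B BV).
  rewrite mulrC => /(supported_wt_primary gB).
  by rewrite mpolyXn supportedX /wt_ge wtMn inE aB.
have a0 : tofrac ('X_a ^+ s : R) != 0.
  by rewrite tofrac_eq0; apply/eqP=> a0; apply: aP; rewrite a0; case: idP.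
(* Write [f] as [1 / x_a^s] times [x_a^s f]; the latter lies in [I(G)^s] by [edge_pow_mulX] applied
   to each monomial of [f]. *)
exists 1%N, (fun=> tofrac 1 / tofrac ('X_a ^+ s)), (fun=> 'X_a ^+ s * f); split.
- by exists 1, ('X_a ^+ s).
- move=> _; pose K h := ideal_pow (edge_ideal k e) s ('X_a ^+ s * h).
  have idK : is_ideal K.
    have [g0 gD gM] := ideal_gen_ideal (fun p => exists g : 'I_s -> R,
      (forall i, edge_ideal k e (g i)) /\ p = \prod_i g i).
    rewrite /K; split=> [|h h' Kh Kh'|b h Kh]; first by rewrite mulr0.
      by rewrite mulrDr; apply: gD.
    by rewrite mulrCA; apply: gM.
  refine (supported_sub idK _ (fV B BV)) => m mB.
  by apply: edge_pow_mulX; rewrite (pblockE BV aB).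
- by rewrite big_ord1 tofrac1 mul1r tofracM mulKf.
Qed.

(** Trading [x_q] for [x_p] can lower the weight only outside the part [B] of [p], and only if [q]
    is not in [B]. *)
Lemma min_primes_pow_exchange s (u v : 'X_{1..n}) p :
    mdeg u = mdeg v -> min_primes_pow s u -> min_primes_pow s v -> (v p < u p)%N ->
  exists2 q, (u q < v q)%N & min_primes_pow s (v + U_(p) - U_(q))%MM.
Proof.
move=> uv /min_primes_powP us /min_primes_powP vs vup.
pose B := pblock V p.
(* If the weight of [v] outside [B] exceeds [s], any [q] with [u q < v q] will do. If it equals [s],
   comparing degrees gives [wt B u <= wt B v], and [q] is found inside [B]. *)
have [q qB uq] : exists2 q, (q \in B) || (s < wt (~: B) v)%N & (u q < v q)%N.
  have := vs B (pblockV p); rewrite leq_eqVlt => /orP[/eqP sv|sv].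
    have wuv : (wt B u <= wt B v)%N.
      by rewrite -(leq_add2r s) {2}sv -mdeg_wt -uv (mdeg_wt B) leq_add2l us ?pblockV.
    by have [q qB uq] := wt_exchange (mem_pblockV p) vup wuv; exists q; rewrite ?qB.
  have wuv : (wt [set: 'I_n] u <= wt [set: 'I_n] v)%N.
    by rewrite !wt_setT uv.
  by have [q _ uq] := wt_exchange (in_setT p) vup wuv; exists q; rewrite ?sv ?orbT.
exists q => //; apply/min_primes_powP=> C CV.
have qvp : (U_(q) <= v + U_(p))%MM.
  by rewrite lep1mP -lt0n mnmDE addn_gt0 (leq_ltn_trans (leq0n _) uq).
(* Adding [U_(q)] back to both sides avoids truncated subtraction. *)
have := congr1 (wt (~: C)) (submK qvp); rewrite !wtD !wt1 !inE => E.
rewrite -(leq_add2r (q \notin C)) E.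
have vC := vs C CV.
have [pC|pC] /= := boolP (p \in C); last first.
  by apply: leq_add => //; apply: leq_b1.
rewrite addn0; rewrite /B (pblockE CV pC) in qB.
by case/orP: qB => [->|sv]; rewrite ?addn0 //; case: (q \in C); rewrite ?addn0 ?addn1.
Qed.

Lemma linear_quotients_min_primes_pow s d :
  linear_quotients (degree_part (min_primes_pow s) d).
Proof.
apply: linear_quotients_exchange; first exact: degree_part_sorted.
move=> u v; rewrite !mem_degree_part => /andP[us /eqP ud] /andP[vs /eqP vd].
have uv : mdeg v = mdeg u by rewrite vd.
move=> /(ltmcP uv) [p vup_eq vup]; exists p => //.
have [q uq v's] := min_primes_pow_exchange (esym uv) us vs vup.
have pq : p != q by apply: contraTneq uq => <-; rewrite -leqNgt ltnW.
have qvp : (U_(q) <= v + U_(p))%MM.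
  by rewrite lep1mP -lt0n mnmDE addn_gt0 (leq_ltn_trans (leq0n _) uq).
have v'd : mdeg (v + U_(p) - U_(q))%MM = d.
  have := congr1 (@mdeg n) (submK qvp); rewrite !mdegD !mdeg1 vd => /eqP.
  by rewrite eqn_add2r => /eqP.
exists (v + U_(p) - U_(q))%MM; split; last exact: lem_subr.
  by rewrite mem_degree_part v's v'd eqxx.
apply/ltmcP; first by rewrite vd.
(* Below [p] the exponents [u] and [v] agree, while [u q < v q]; so [q] is not below [p], and the
   new exponent first differs from [v] at [p], where it is larger by one. *)
exists p => [j jp|]; rewrite mnmBE mnmDE !mnm1E.
  have -> : (p == j) = false by apply/eqP=> pj; rewrite pj ltnn in jp.
  have -> : (q == j) = false.
    by apply/eqP=> qj; move: uq; rewrite qj vup_eq // ltnn.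
  by rewrite addn0 subn0.
by rewrite eqxx [q == p]eq_sym (negPf pq) subn0 addn1.
Qed.

End CompleteMultipartite.

Theorem corollary5p22 (k : fieldType) (n m : nat) (e : rel 'I_n)
  (e_sym : ssrbool.symmetric e) (e_irr : irreflexive e)
  (m_ge2 : (2 <= m)%N) (e_cmp : complete_multipartite m e)
  (s : nat) (s_ge1 : (1 <= s)%N) :
  componentwise_linear (symbolic_power (edge_ideal k e) s).
Proof.
have [V [partV cardV eV]] := e_cmp.
have V0 : V != set0 by rewrite -card_gt0 cardV ltnW.
apply: (@componentwise_linear_supported _ _ (min_primes_pow V s)).
- exact: min_primes_pow_upclosed.
- by move=> f; apply: symbolic_powerE.
- by move=> d; apply: linear_quotients_min_primes_pow.
Qed.
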